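(* Let $(M,g)$ be a Riemannian manifold. (Hessian version) The following two conditions are equivalent. (a) There exist a $C^2$ function $\gamma:M\to[0,+\infty)$, a compact set $K\subset M$, constants $A,B>0$ and an admissible function $G:[0,+\infty)\to[0,+\infty)$ such that $\gamma$ is proper, $|\nabla\gamma|\le A\sqrt{\gamma}$ on $M\setminus K$, and $\mathrm{Hess}\,\gamma\le B\sqrt{\gamma\, G(\sqrt{\gamma})}\,g$ on $M\setminus K$. (b) There exist a $C^2$ function $\phi:M\to\mathbb{R}$ and constants $C,D>0$ such that $\phi$ is proper, $|\nabla\phi|\le C$ on $M$, and $\mathrm{Hess}\,\phi\le D g$ on $M$. (Laplacian version) The following two conditions are equivalent. (a') There exist a $C^2$ function $\gamma:M\to[0,+\infty)$, a compact set $K\subset M$, constants $A,B>0$ and an admissible function $G:[0,+\infty)\to[0,+\infty)$ such that $\gamma$ is proper, $|\nabla\gamma|\le A\sqrt{\gamma}$ on $M\setminus K$, and $\Delta\gamma\le B\sqrt{\gamma\, G(\sqrt{\gamma})}$ on $M\setminus K$. (b') There exist a $C^2$ function $\phi:M\to\mathbb{R}$ and constants $C,D>0$ such that $\phi$ is proper, $|\nabla\phi|\le C$ on $M$, and $\Delta\phi\le D$ on $M$.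
   Context: A function $\phi:M\to\mathbb{R}$ is called proper if $\phi(x)\to+\infty$ as $x\to\infty$, i.e. for every $R\in\mathbb{R}$ there is a compact set $K_R\subset M$ with $\phi>R$ on $M\setminus K_R$. A function $G:[0,+\infty)\to[0,+\infty)$ is called admissible here if it is smooth and satisfies $$G(0)>0,\qquad G'(t)\ge 0\ \text{ for all } t\ge0,\qquad \int_0^{+\infty}\frac{dt}{\sqrt{G(t)}}=+\infty,\qquad \limsup_{t\to+\infty}\frac{t\,G(\sqrt t)}{G(t)}<+\infty.$$ Here $\nabla$, $\mathrm{Hess}$ and $\Delta=\mathrm{tr}_g\mathrm{Hess}$ are the gradient, Hessian and Laplacian of $(M,g)$. Inequalities between Hessians and multiples of $g$ are in the sense of quadratic forms: $\mathrm{Hess}\,\psi\le \lambda g$ at $x$, for a function $\lambda$, means $\mathrm{Hess}\,\psi(x)(v,v)\le\lambda(x)|v|^2$ for all $v\in T_xM$. Completeness of $M$ is not assumed. *)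

(* Defs.v *)
From HB Require Import structures.
From mathcomp Require Import all_boot all_order all_algebra.
From mathcomp Require Import all_classical all_reals all_analysis.

Set Implicit Arguments.
Unset Strict Implicit.
Unset Printing Implicit Defensive.

Import Order.TTheory GRing.Theory Num.Theory.
Import numFieldNormedType.Exports.

Local Open Scope classical_set_scope.
Local Open Scope ring_scope.

(* Points and vectors of R^n are row vectors 'rV[R]_n, and
   ''e_i' is the i-th vector of the standard basis, so that 'D_('e_i) is the
   i-th partial derivative. *)

(* [Ck U k f]: f is of class C^k on U.  Meant for open U: only the germs of f
   at the points of U matter then. *)
Fixpoint Ck (R : realType) (n : nat) (U : set 'rV[R]_n) (k : nat)
    (f : 'rV[R]_n -> R) : Prop :=
  (forall x, U x -> {for x, continuous f}) /\
  (if k is k'.+1 then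
     forall i : 'I_n, (forall x, U x -> derivable f x 'e_i) /\
                      Ck U k' (fun x => 'D_('e_i) f x)
   else True).

Definition smooth (R : realType) (n : nat) (U : set 'rV[R]_n)
    (f : 'rV[R]_n -> R) : Prop := forall k, Ck U k f.

(* [chart_inv c] is the inverse of [chart_map c] on [chart_codom c], arbitrary
   elsewhere.  Domain and codomain being open, the two continuity conditions
   are those of the restricted maps. *)
Record chart (R : realType) (n : nat) (M : topologicalType) := Chart {
  chart_dom : set M;
  chart_map :> M -> 'rV[R]_n;
  chart_inv : 'rV[R]_n -> M;
  chart_dom_open : open chart_dom;
  chart_codom_open : open (chart_map @` chart_dom);
  chart_mapK : forall x, chart_dom x -> chart_inv (chart_map x) = x;
  chart_map_continuous :
    forall x, chart_dom x -> {for x, continuous chart_map};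
  chart_inv_continuous :
    forall x, chart_dom x -> {for chart_map x, continuous chart_inv} }.

Definition chart_codom (R : realType) (n : nat) (M : topologicalType)
  (c : chart R n M) : set 'rV[R]_n := c @` chart_dom c.

Definition transition (R : realType) (n : nat) (M : topologicalType)
  (c d : chart R n M) : 'rV[R]_n -> 'rV[R]_n := fun y => d (chart_inv c y).

Definition overlap (R : realType) (n : nat) (M : topologicalType)
  (c d : chart R n M) : set 'rV[R]_n := c @` (chart_dom c `&` chart_dom d).

(* Smooth n-dimensional manifolds without boundary; n = 0 is allowed, and
   neither connectedness nor nonemptiness is required. *)
Record manifold (R : realType) (n : nat) := Manifold {
  carrier :> topologicalType;
  manifold_hausdorff : hausdorff_space carrier;
  manifold_second_countable : @second_countable carrier;
  atlas : set (chart R n carrier);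
  atlas_cover : forall x : carrier, exists2 c, atlas c & chart_dom c x;
  atlas_smooth : forall c d, atlas c -> atlas d ->
    forall j : 'I_n, smooth (overlap c d) (fun y => transition c d y 0 j) }.

(* A Riemannian metric is given by its matrices in the charts:
   [metric c y] is (g_ij) in the coordinates c at the point y of
   [chart_codom c].  As 'jacobian F y' has entries d_i F_j, the last field is
   the transformation law g_ij = sum_(a, b) d_i F_a d_j F_b g'_ab of a
   (0,2)-tensor under a change of coordinates F. *)
Record riemannian (R : realType) (n : nat) := Riemannian {
  base :> manifold R n;
  metric : chart R n base -> 'rV[R]_n -> 'M[R]_n;
  metric_smooth : forall c, atlas c ->
    forall i j : 'I_n, smooth (chart_codom c) (fun y => metric c y i j);
  metric_sym : forall c y, atlas c -> chart_codom c y ->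
    (metric c y)^T = metric c y;
  metric_posdef : forall c y, atlas c -> chart_codom c y ->
    forall v : 'rV[R]_n, v != 0 -> 0 < (v *m metric c y *m v^T) 0 0;
  metric_change : forall c d y, atlas c -> atlas d -> overlap c d y ->
    metric c y = jacobian (transition c d) y
                 *m metric d (transition c d y)
                 *m (jacobian (transition c d) y)^T }.

Section Geometry.
Context (R : realType) (n : nat) (M : riemannian R n).
Implicit Types (c : chart R n M) (f : M -> R) (x : M) (y : 'rV[R]_n).

(* Geometric objects at a point x are given by their components in the charts
   of the atlas around x; a tangent vector at x is then a vector v of R^n, and
   inequalities between scalars are required in each of these charts. *)
Definition charts_at x : set (chart R n M) :=
  [set c | atlas c /\ chart_dom c x].

Definition CkM (k : nat) f : Prop :=
  forall c, atlas c -> Ck (chart_codom c) k (f \o chart_inv c).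

Definition pderiv c f y (i : 'I_n) : R := 'D_('e_i) (f \o chart_inv c) y.

(* the components g^ij *)
Definition cometric c y : 'M[R]_n := invmx (metric c y).

Definition christoffel c y (k i j : 'I_n) : R :=
  2^-1 * \sum_l cometric c y k l *
    ('D_('e_i) (fun z => metric c z j l) y
     + 'D_('e_j) (fun z => metric c z i l) y
     - 'D_('e_l) (fun z => metric c z i j) y).

Definition inner c x (v w : 'rV[R]_n) : R := (v *m metric c (c x) *m w^T) 0 0.

Definition norm_g c x (v : 'rV[R]_n) : R := Num.sqrt (inner c x v v).

Definition grad c f x : 'rV[R]_n :=
  \row_j \sum_i pderiv c f (c x) i * cometric c (c x) i j.

Definition Hess_mx c f x : 'M[R]_n :=
  \matrix_(i, j) ('D_('e_i) (fun y => pderiv c f y j) (c x)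
                  - \sum_k christoffel c (c x) k i j * pderiv c f (c x) k).

Definition Hess c f x (v w : 'rV[R]_n) : R := (v *m Hess_mx c f x *m w^T) 0 0.

Definition Laplacian c f x : R :=
  \sum_i \sum_j cometric c (c x) i j * Hess_mx c f x i j.

Definition grad_norm_le (S : set M) f (lambda : M -> R) : Prop :=
  forall x c, S x -> charts_at x c -> norm_g c x (grad c f x) <= lambda x.

(* Hess f <= lambda g on S *)
Definition Hess_le (S : set M) f (lambda : M -> R) : Prop :=
  forall x c, S x -> charts_at x c ->
  forall v : 'rV[R]_n, Hess c f x v v <= lambda x * norm_g c x v ^+ 2.

Definition Laplacian_le (S : set M) f (lambda : M -> R) : Prop :=
  forall x c, S x -> charts_at x c -> Laplacian c f x <= lambda x.

Definition proper_fun f : Prop :=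
  forall r : R, exists2 K : set M, compact K & forall x, ~ K x -> r < f x.

End Geometry.

(* A smooth function on [0, +oo[ is represented by a smooth extension to R;
   all the other conditions only involve its values on [0, +oo[. *)
Record admissible (R : realType) (G : R -> R) : Prop := Admissible {
  admissible_smooth : forall (k : nat) (t : R), derivable (derive1n k G) t 1;
  admissible_ge0 : forall t, 0 <= t -> 0 <= G t;
  admissible_gt0 : 0 < G 0;
  admissible_derive : forall t, 0 <= t -> 0 <= derive1 G t;
  admissible_integral :
    (\int[lebesgue_measure]_(t in `[0%R, +oo[) ((Num.sqrt (G t))^-1)%:E
     = +oo)%E;
  admissible_limsup :
    (limf_esup (fun t : R => (t * G (Num.sqrt t) / G t)%:E) (pinfty_nbhs R)
     < +oo)%E }.

(* Main.v *)
Require Import Defs.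
From mathcomp Require Import all_boot all_order all_algebra.
From mathcomp Require Import all_classical all_reals all_analysis.
From mathcomp Require Import measurable_realfun.
From mathcomp Require Import ring lra.
Set Implicit Arguments.
Unset Strict Implicit.
Unset Printing Implicit Defensive.
Import Order.TTheory GRing.Theory Num.Theory.
Import numFieldNormedType.Exports.
Local Open Scope classical_set_scope.
Local Open Scope ring_scope.

(** Everything rests on the behaviour of gradient, Hessian and Laplacian under
    composition with a function of one variable: at a point [x], in any chart,
<<
      grad (psi o f) = psi'(f) grad f
      Hess (psi o f) = psi'(f) Hess f + psi''(f) df (x) df
       Lap (psi o f) = psi'(f) Lap f + psi''(f) |grad f|^2.
>>
    When [0 <= psi'(f)], upper bounds on [Hess f] (or [Lap f]) and on
    [|grad f|] therefore give an upper bound on [Hess (psi o f)] (or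
    [Lap (psi o f)]); for the Hessian the term in [psi''] is controlled by the
    Cauchy-Schwarz inequality [df(v)^2 <= |grad f|^2 |v|^2].  The record
    [second_order_bound] isolates the few properties that the Hessian and the
    Laplacian share, and the equivalence is proved once for any such bound.

    From [gamma] to [phi] ([admissible_to_bounded]), three compositions are
    performed.
    - With [w = sqrt (1 + gamma)], outside [K] the gradient of [w] is bounded
      and its Hessian is at most a constant times [sqrt (G w)], the square root
      being increasing and concave.
    - With [p = F w], where [F' = 1 / sqrt G] ([primitive_inv_sqrt]), the factor
      [sqrt (G w)] cancels, and [F'' <= 0] because [G] is nondecreasing; hence
      [p] has bounded gradient and Hessian bounded above outside [K].  It is
      proper because [F] is unbounded, the integral of [1 / sqrt G] being
      infinite ([primitive_unbounded]).
    - No bound is known on the compact set [K].  If [p <= T] on [K], then [p] is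
      composed with a function [psi] whose first two derivatives vanish on
      [t <= T], with [0 <= psi' <= 2] and [psi'' <= 3], and which still tends
      to infinity ([cutoff_exists], [bound_across_compact]); the derivatives of
      the composite vanish on [K], so that no comparison between the charts of
      the atlas is needed there.

    From [phi] to [gamma] ([bounded_to_admissible]): [phi] is bounded below by
    some [m], and [gamma = (phi + 1 - m)^2] works with [G t = 1 + t^2] and an
    empty compact set. *)

(** * Chain rule and functions of class C^k *)

Lemma eq_continuous_at (T U : topologicalType) (f g : T -> U) (x : T) :
  (\forall y \near x, f y = g y) ->
  {for x, continuous f} -> {for x, continuous g}.
Proof.
move=> fg cf; rewrite /prop_for /continuous_at -(nbhs_singleton fg).
exact: cvg_trans (near_eq_cvg fg) cf.
Qed.

Section ChainRule.
Context {R : realType}.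

(** The derivative of [f] at [x] along [v] is the derivative at 0 of [f]
    restricted to the line through [x] directed by [v]. *)
Lemma is_derive_line (V : normedModType R) (f : V -> R) (x v : V) (a : R) :
  is_derive x v f a <-> is_derive (0 : R) 1 (fun h : R => f (h *: v + x)) a.
Proof.
have E : 'D_v f x = 'D_1 (fun h : R => f (h *: v + x)) 0.
  rewrite /derive; set g1 := fun h => h^-1 *: _; set g2 := fun h => h^-1 *: _.
  suff -> : g1 = g2 by [].
  apply/funext => h; rewrite /g1 /g2 /=.
  by rewrite addr0 scale0r add0r [_%:A]mulr1.
split=> -[df <-]; [rewrite E | rewrite -E]; apply: derivableP.
  exact: (derivable1P _ _ _).1 df.
exact: (derivable1P _ _ _).2 df.
Qed.

Lemma is_derive_comp1 (V : normedModType R) (g : R -> R) (f : V -> R)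
    (x v : V) (a b : R) :
  is_derive (f x) 1 g a -> is_derive x v f b ->
  is_derive x v (g \o f) (a * b).
Proof.
move=> dg /is_derive_line df; apply/is_derive_line.
by apply: (@is_derive1_comp R g); rewrite /= scale0r add0r.
Qed.

(** [psi] is of class C^2 on [V], with first and second derivatives [dpsi] and
    [ddpsi].  Derivatives are two-sided: at a boundary point of [V] they also
    involve the values of [psi] outside [V]. *)
Record C2_on (V : set R) (psi dpsi ddpsi : R -> R) : Prop := C2On {
  C2_on_derive : forall t, V t -> is_derive t 1 psi (dpsi t);
  C2_on_derive2 : forall t, V t -> is_derive t 1 dpsi (ddpsi t);
  C2_on_continuous : forall t, V t -> {for t, continuous ddpsi} }.

Lemma is_derive_continuous (f : R -> R) (t a : R) :
  is_derive t 1 f a -> {for t, continuous f}.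
Proof.
by move=> [df _]; apply: differentiable_continuous; apply/derivable1_diffP.
Qed.

End ChainRule.

Section CkTheory.
Context {R : realType} {n : nat}.
Implicit Types (U : set 'rV[R]_n) (f g : 'rV[R]_n -> R).

Lemma Ck_cont U k f : Ck U k f -> forall x, U x -> {for x, continuous f}.
Proof. by case: k => [|k] []. Qed.

Lemma eq_on_open U f g x : open U -> {in U, f =1 g} -> U x ->
  \forall y \near x, f y = g y.
Proof.
move=> oU fg Ux; near=> y; apply: fg; rewrite inE.
by near: y; exact: open_nbhs_nbhs.
Unshelve. all: by end_near. Qed.

Lemma eq_Ck U k f g : open U -> {in U, f =1 g} -> Ck U k f -> Ck U k g.
Proof.
move=> oU; elim: k f g => [|k IH] f g fg [cf df].
  split=> // x Ux; exact: eq_continuous_at (eq_on_open oU fg Ux) (cf x Ux).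
split=> [x Ux|i].
  exact: eq_continuous_at (eq_on_open oU fg Ux) (cf x Ux).
have [dfi Ci] := df i; split => [x Ux|].
  exact: near_eq_derivable (eq_on_open oU fg Ux) (dfi x Ux).
apply: IH Ci => y; rewrite inE => Uy; apply: near_eq_derive.
exact: eq_on_open oU fg Uy.
Qed.

Lemma CkW U k f : Ck U k.+1 f -> Ck U k f.
Proof.
elim: k f => [|k IH] f [cf df]; split => // i.
by have [? ?] := df i; split => //; apply: IH.
Qed.

Lemma Ck_add U k f g : open U -> Ck U k f -> Ck U k g -> Ck U k (f + g).
Proof.
move=> oU; elim: k f g => [|k IH] f g [cf df] [cg dg].
  by split => // x Ux; apply: continuousD; [exact: cf|exact: cg].
split=> [x Ux|i].
  by apply: continuousD; [exact: cf|exact: cg].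
have [dfi Cf] := df i; have [dgi Cg] := dg i; split => [x Ux|].
  by apply: derivableD; [exact: dfi|exact: dgi].
apply: eq_Ck (IH _ _ Cf Cg) => // x; rewrite inE => Ux.
by rewrite /= deriveD//; [exact: dfi|exact: dgi].
Qed.

Lemma Ck_mul U k f g : open U -> Ck U k f -> Ck U k g -> Ck U k (f * g).
Proof.
move=> oU; elim: k f g => [|k IH] f g Cf Cg.
  split => // x Ux.
  by apply: continuousM; [exact: (Ck_cont Cf)|exact: (Ck_cont Cg)].
split=> [x Ux|i].
  by apply: continuousM; [exact: (Ck_cont Cf)|exact: (Ck_cont Cg)].
have [_ /(_ i)[dfi Cfi]] := Cf; have [_ /(_ i)[dgi Cgi]] := Cg.
split => [x Ux|].
  by apply: derivableM; [exact: dfi|exact: dgi].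
apply: eq_Ck (Ck_add oU (IH _ _ (CkW Cf) Cgi) (IH _ _ (CkW Cg) Cfi)) => // x.
by rewrite inE => Ux; rewrite /= deriveM//; [exact: dfi|exact: dgi].
Qed.

Lemma derive_comp1 U f (g dg : R -> R) (W : set R) (i : 'I_n) :
  (forall y, U y -> W (f y)) ->
  (forall t, W t -> is_derive t 1 g (dg t)) ->
  (forall y, U y -> derivable f y 'e_i) ->
  forall y, U y -> is_derive y 'e_i (g \o f) (dg (f y) * 'D_('e_i) f y).
Proof.
move=> UW gd fd y Uy; apply: is_derive_comp1; first exact/gd/UW.
exact/derivableP/fd.
Qed.

Lemma C2_comp U f (W : set R) (psi dpsi ddpsi : R -> R) :
  open U -> (forall y, U y -> W (f y)) -> C2_on W psi dpsi ddpsi ->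
  Ck U 2 f -> Ck U 2 (psi \o f).
Proof.
move=> oU UW [d1 d2 c2] Cf.
have cont (g dg : R -> R) : (forall t, W t -> is_derive t 1 g (dg t)) ->
    forall y, U y -> {for y, continuous (g \o f)}.
  move=> gd y Uy; apply: continuous_comp; first exact: (Ck_cont Cf).
  exact: is_derive_continuous (gd _ (UW _ Uy)).
have dfi i : forall y, U y -> derivable f y 'e_i by have [_ /(_ i)[]] := Cf.
have C1 : Ck U 1 (dpsi \o f).
  split=> [|i]; first exact: (cont _ _ d2).
  have D := derive_comp1 UW d2 (dfi i).
  split=> [y Uy|]; first by have [] := D y Uy.
  apply: (@eq_Ck _ _ ((ddpsi \o f) * 'D_('e_i) f)) => //.
    by move=> y; rewrite inE => Uy; have [_ ->] := D y Uy.
  split => // y Uy; apply: continuousM.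
    by apply: continuous_comp; [exact: (Ck_cont Cf)|exact/c2/UW].
  by have [_ /(_ i)[_ [+ _]]] := Cf; apply.
split=> [|i]; first exact: (cont _ _ d1).
have D := derive_comp1 UW d1 (dfi i).
split=> [y Uy|]; first by have [] := D y Uy.
apply: (@eq_Ck _ _ ((dpsi \o f) * 'D_('e_i) f)) => //.
  by move=> y; rewrite inE => Uy; have [_ ->] := D y Uy.
by apply: Ck_mul => //; have [_ /(_ i)[]] := Cf.
Qed.

End CkTheory.

(** * Gradient, Hessian and Laplacian of a composite function *)

Section Pointwise.
Context {R : realType} {n : nat} {M : riemannian R n}.
Implicit Types (c : chart R n M) (f : M -> R) (x : M) (v w : 'rV[R]_n).

Lemma chart_codom_map c x : chart_dom c x -> chart_codom c (c x).
Proof. by move=> cx; exists x. Qed.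

Lemma open_chart_codom c : open (chart_codom c).
Proof. exact: chart_codom_open. Qed.

Lemma innerC c x v w : charts_at x c -> inner c x v w = inner c x w v.
Proof.
move=> [ac cx]; have tr (A : 'M[R]_1) : A 0 0 = A^T 0 0 by rewrite mxE.
rewrite /inner [LHS]tr !trmx_mul trmxK mulmxA.
by rewrite (Defs.metric_sym ac (chart_codom_map cx)).
Qed.

Lemma innerDl c x u v w : inner c x (u + v) w = inner c x u w + inner c x v w.
Proof. by rewrite /inner !mulmxDl mxE. Qed.

Lemma innerZl c x a v w : inner c x (a *: v) w = a * inner c x v w.
Proof. by rewrite /inner -!scalemxAl mxE. Qed.

Lemma inner_ge0 c x v : charts_at x c -> 0 <= inner c x v v.
Proof.
move=> [ac cx]; have [->|v0] := eqVneq v 0.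
  by rewrite /inner !mul0mx mxE.
exact/ltW/(metric_posdef ac (chart_codom_map cx)).
Qed.

Lemma sqr_norm_g c x v : charts_at x c -> norm_g c x v ^+ 2 = inner c x v v.
Proof. by move=> cx; rewrite sqr_sqrtr// inner_ge0. Qed.

Lemma norm_gZ c x a v : norm_g c x (a *: v) = `|a| * norm_g c x v.
Proof.
rewrite /norm_g innerZl /inner [(a *: v)^T]linearZ/= -scalemxAr mxE mulrA.
by rewrite -expr2 sqrtrM ?sqr_ge0// sqrtr_sqr.
Qed.

Lemma inner_cauchy_schwarz c x v w : charts_at x c ->
  inner c x v w ^+ 2 <= inner c x v v * inner c x w w.
Proof.
move=> cx; have [->|w0] := eqVneq w 0.
  by rewrite /inner trmx0 !mulmx0 !mxE expr0n/= mulr0.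
have b0 : 0 < inner c x w w.
  by case: cx => ac cx; exact: (metric_posdef ac (chart_codom_map cx)).
(* the square of the length of this vector is |w|^2 times the difference *)
have := inner_ge0 (inner c x w w *: v + (- inner c x v w) *: w) cx.
rewrite innerDl !innerZl ![inner c x _ (_ + _)]innerC// !innerDl !innerZl.
rewrite [inner c x w v]innerC//.
set a := inner c x v v; set b := inner c x w w in b0 *; set d := inner c x v w.
have -> : b * (b * a + - d * d) + - d * (b * d + - d * b)
    = b * (a * b - d ^+ 2) by ring.
by rewrite pmulr_rge0// subr_ge0.
Qed.

(** A vector in the kernel of the metric would have length zero. *)
Lemma metric_unitmx c x : charts_at x c -> metric c (c x) \in unitmx.
Proof.
move=> [ac cx]; rewrite -row_free_unit; apply/row_freeP.
exists (invmx (metric c (c x))); rewrite mulmxV// unitmxE unitfE.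
apply/negP => /det0P[v v0 vM].
have := metric_posdef ac (chart_codom_map cx) v0.
by rewrite vM mul0mx mxE ltxx.
Qed.

(** The components of [df] at [x] in the chart [c], as a row vector. *)
Definition differential c f x : 'rV[R]_n := \row_i pderiv c f (c x) i.

Lemma grad_differential c f x :
  grad c f x = differential c f x *m cometric c (c x).
Proof.
by apply/rowP => j; rewrite !mxE; apply: eq_bigr => i _; rewrite mxE.
Qed.

Lemma inner_grad c f x v : charts_at x c ->
  inner c x (grad c f x) v = (differential c f x *m v^T) 0 0.
Proof.
by move=> cx; rewrite /inner grad_differential mulmxKV// metric_unitmx.
Qed.

Lemma sqr_norm_grad c f x : charts_at x c ->
  norm_g c x (grad c f x) ^+ 2 =
  (differential c f x *m cometric c (c x) *m (differential c f x)^T) 0 0.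
Proof.
move=> cx; have tr (A : 'M[R]_1) : A 0 0 = A^T 0 0 by rewrite mxE.
by rewrite sqr_norm_g// inner_grad// tr trmx_mul trmxK grad_differential.
Qed.

Section Composition.
Variables (f : M -> R) (W : set R) (psi dpsi ddpsi : R -> R).
Hypothesis f2 : CkM 2 f.
Hypothesis fW : forall x, W (f x).
Hypothesis psi2 : C2_on W psi dpsi ddpsi.

Lemma CkM2_comp : CkM 2 (psi \o f).
Proof.
move=> c ac.
have fWc y : chart_codom c y -> W ((f \o chart_inv c) y) by move=> _; exact: fW.
exact: (C2_comp (@open_chart_codom c) fWc psi2 (f2 ac)).
Qed.

Lemma pderiv_comp c y i : atlas c -> chart_codom c y ->
  pderiv c (psi \o f) y i = dpsi (f (chart_inv c y)) * pderiv c f y i.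
Proof.
move=> ac cy; have [_ /(_ i)[fd _]] := f2 ac.
have [] := derive_comp1 (U := chart_codom c) _ (C2_on_derive psi2) fd cy.
  by move=> z _; exact: fW.
by [].
Qed.

Lemma differential_comp c x : charts_at x c ->
  differential c (psi \o f) x = dpsi (f x) *: differential c f x.
Proof.
move=> [ac cx]; apply/rowP => i; rewrite !mxE pderiv_comp ?chart_mapK//.
exact: chart_codom_map.
Qed.

Lemma grad_comp c x : charts_at x c ->
  grad c (psi \o f) x = dpsi (f x) *: grad c f x.
Proof.
by move=> cx; rewrite !grad_differential differential_comp// scalemxAl.
Qed.

Lemma Hess_mx_comp c x : charts_at x c ->
  Hess_mx c (psi \o f) x = dpsi (f x) *: Hess_mx c f x
    + ddpsi (f x) *: ((differential c f x)^T *m differential c f x).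
Proof.
move=> [ac cx]; have cy := chart_codom_map cx.
apply/matrixP => i j; rewrite !mxE big_ord1 !mxE.
have -> : \sum_k christoffel c (c x) k i j * pderiv c (psi \o f) (c x) k =
    dpsi (f x) * \sum_k christoffel c (c x) k i j * pderiv c f (c x) k.
  rewrite big_distrr/=; apply: eq_bigr => k _.
  by rewrite pderiv_comp// chart_mapK// mulrCA.
have [_ df] := f2 ac; have [dfi _] := df i; have [_ [_ /(_ i)[dfij _]]] := df j.
have [D1 D2] := derive_comp1 (U := chart_codom c) (fun z _ => fW _)
  (C2_on_derive2 psi2) dfi cy.
have -> : 'D_('e_i) (fun y => pderiv c (psi \o f) y j) (c x) =
   'D_('e_i) ((dpsi \o (f \o chart_inv c)) * 'D_('e_j) (f \o chart_inv c))
     (c x).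
  apply: near_eq_derive; apply: (eq_on_open (@open_chart_codom c) _ cy).
  by move=> y; rewrite inE => Uy; exact: pderiv_comp.
rewrite deriveM//; last exact: dfij.
rewrite D2 /= chart_mapK// /GRing.scale/= /pderiv; ring.
Qed.

End Composition.
End Pointwise.

(** * Upper bounds on second-order operators *)

Section SecondOrderBounds.
Context {R : realType} {n : nat} {M : riemannian R n}.
Implicit Types (c : chart R n M) (f : M -> R) (x : M) (v w : 'rV[R]_n).
Implicit Types (psi dpsi ddpsi : R -> R) (W : set R).

(** [P c f x l] reads: the second-order operator at hand, applied to [f] and
    computed at [x] in the chart [c], is at most [l].  The record lists the
    properties that the proof uses: such a bound can be weakened, it behaves as
    expected under composition with a function whose derivative at [f x] is
    nonnegative, and composition with a function whose first two derivatives
    vanish at [f x] gives the bound 0 without assuming any bound for [f]. *)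
Record second_order_bound (P : chart R n M -> (M -> R) -> M -> R -> Prop) :
    Prop := SecondOrderBound {
  sob_le : forall c f x l l', charts_at x c -> l <= l' ->
    P c f x l -> P c f x l';
  sob_comp : forall c f x l a e W psi dpsi ddpsi,
    CkM 2 f -> (forall z, W (f z)) -> C2_on W psi dpsi ddpsi ->
    charts_at x c -> 0 <= dpsi (f x) -> ddpsi (f x) <= e -> 0 <= e ->
    norm_g c x (grad c f x) <= a -> P c f x l ->
    P c (psi \o f) x (dpsi (f x) * l + e * a ^+ 2);
  sob_flat : forall c f x W psi dpsi ddpsi,
    CkM 2 f -> (forall z, W (f z)) -> C2_on W psi dpsi ddpsi ->
    charts_at x c -> dpsi (f x) = 0 -> ddpsi (f x) = 0 ->
    P c (psi \o f) x 0 }.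

(** [Hess f <= l g] at [x]. *)
Definition hess_bound c f x (l : R) : Prop :=
  forall v, Hess c f x v v <= l * norm_g c x v ^+ 2.

Definition laplacian_bound c f x (l : R) : Prop := Laplacian c f x <= l.

Lemma norm_g_ge0 c x v : 0 <= norm_g c x v.
Proof. exact: sqrtr_ge0. Qed.

Lemma sob_hess : second_order_bound hess_bound.
Proof.
have HC c f x W psi dpsi ddpsi v :
    CkM 2 f -> (forall z, W (f z)) -> C2_on W psi dpsi ddpsi ->
    charts_at x c -> Hess c (psi \o f) x v v =
    dpsi (f x) * Hess c f x v v + ddpsi (f x) * inner c x (grad c f x) v ^+ 2.
  move=> f2 fW psi2 cx; rewrite /Hess (Hess_mx_comp f2 fW psi2 cx).
  have tr (A : 'M[R]_1) : A 0 0 = A^T 0 0 by rewrite mxE.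
  rewrite mulmxDr mulmxDl -!scalemxAr -!scalemxAl.
  rewrite [LHS]mxE [X in X + _]mxE [X in _ + X]mxE.
  congr (_ + _ * _); rewrite inner_grad//.
  rewrite mulmxA -(mulmxA (v *m _)) [LHS]mxE big_ord1.
  by rewrite [X in X * _]tr trmx_mul trmxK expr2.
split=> [c f x l l' cx ll' P v|c f x l a e W psi dpsi ddpsi f2 fW psi2 cx d0 de
  e0 ga P v|c f x W psi dpsi ddpsi f2 fW psi2 cx d0 dd0 v].
- by apply: le_trans (P v) _; rewrite ler_wpM2r ?sqr_ge0.
- rewrite (HC _ _ _ _ _ _ _ v f2 fW psi2 cx) mulrDl -!mulrA lerD//.
    by rewrite ler_wpM2l.
  apply: (@le_trans _ _ (e * inner c x (grad c f x) v ^+ 2)).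
    by rewrite ler_wpM2r ?sqr_ge0.
  rewrite ler_wpM2l//; apply: le_trans (inner_cauchy_schwarz _ _ cx) _.
  rewrite [leRHS]mulrA -expr2 -!sqr_norm_g// ler_wpM2r ?sqr_ge0//.
  by rewrite ler_sqr ?nnegrE ?norm_g_ge0// (le_trans (norm_g_ge0 _ _ _) ga).
- by rewrite (HC _ _ _ _ _ _ _ v f2 fW psi2 cx) d0 dd0 !mul0r addr0.
Qed.

Lemma sob_laplacian : second_order_bound laplacian_bound.
Proof.
have LC c f x W psi dpsi ddpsi :
    CkM 2 f -> (forall z, W (f z)) -> C2_on W psi dpsi ddpsi ->
    charts_at x c -> Laplacian c (psi \o f) x =
    dpsi (f x) * Laplacian c f x
    + ddpsi (f x) * norm_g c x (grad c f x) ^+ 2.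
  move=> f2 fW psi2 cx; rewrite sqr_norm_grad// /Laplacian.
  rewrite (Hess_mx_comp f2 fW psi2 cx) mxE !big_distrr/=.
  under [X in _ = _ + X]eq_bigr do rewrite mxE mulr_suml mulr_sumr.
  rewrite [X in _ = _ + X]exchange_big/= -big_split/=; apply: eq_bigr => i _.
  rewrite big_distrr/= -big_split/=; apply: eq_bigr => j _.
  rewrite !mxE big_ord1 !mxE; ring.
rewrite /laplacian_bound.
split=> [c f x l l' cx ll' P|c f x l a e W psi dpsi ddpsi f2 fW psi2 cx d0 de
  e0 ga P|c f x W psi dpsi ddpsi f2 fW psi2 cx d0 dd0].
- exact: le_trans ll'.
- rewrite (LC _ _ _ _ _ _ _ f2 fW psi2 cx) lerD ?ler_wpM2l//.
  apply: (@le_trans _ _ (e * norm_g c x (grad c f x) ^+ 2)).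
    by rewrite ler_wpM2r ?sqr_ge0.
  rewrite ler_wpM2l//.
  by rewrite ler_sqr ?nnegrE ?norm_g_ge0// (le_trans (norm_g_ge0 _ _ _) ga).
- by rewrite (LC _ _ _ _ _ _ _ f2 fW psi2 cx) d0 dd0 !mul0r addr0.
Qed.

(** The bound [P] holds for [f] at every point [x] of [S], in every chart of the
    atlas around [x], with the upper bound [l x]. *)
Definition bound_on (P : chart R n M -> (M -> R) -> M -> R -> Prop)
    (S : set M) f (l : M -> R) : Prop :=
  forall x c, S x -> charts_at x c -> P c f x (l x).

Section Comp.
Variables (f : M -> R) (W : set R) (psi dpsi ddpsi : R -> R).
Hypothesis f2 : CkM 2 f.
Hypothesis fW : forall x, W (f x).
Hypothesis psi2 : C2_on W psi dpsi ddpsi.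

Lemma grad_norm_le_comp (S : set M) (a b : M -> R) :
  grad_norm_le S f a -> (forall x, S x -> 0 <= dpsi (f x)) ->
  (forall x, S x -> dpsi (f x) * a x <= b x) ->
  grad_norm_le S (psi \o f) b.
Proof.
move=> fa d0 ab x c Sx cx.
rewrite (grad_comp f2 fW psi2 cx) norm_gZ ger0_norm ?d0//.
by apply: le_trans (ab x Sx); rewrite ler_wpM2l ?d0//; exact: fa.
Qed.

Lemma bound_on_comp P (S : set M) (a l e m : M -> R) :
  second_order_bound P -> grad_norm_le S f a -> bound_on P S f l ->
  (forall x, S x -> 0 <= dpsi (f x)) ->
  (forall x, S x -> ddpsi (f x) <= e x) -> (forall x, S x -> 0 <= e x) ->
  (forall x, S x -> dpsi (f x) * l x + e x * a x ^+ 2 <= m x) ->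
  bound_on P S (psi \o f) m.
Proof.
move=> Pb fa fl d0 de e0 lm x c Sx cx.
apply: (sob_le Pb cx (lm x Sx)).
apply: (sob_comp Pb f2 fW psi2 cx); [exact: d0|exact: de|exact: e0| |].
  exact: fa.
exact: fl.
Qed.

End Comp.

Lemma CkM_continuous k f : CkM k f -> continuous f.
Proof.
move=> fk x; have [c ac cx] := atlas_cover x.
have cinv : {for x, continuous ((f \o chart_inv c) \o c)}.
  apply: continuous_comp; first exact: chart_map_continuous.
  exact: (Ck_cont (fk c ac) (chart_codom_map cx)).
have E : \forall y \near x, ((f \o chart_inv c) \o c) y = f y.
  near=> y; rewrite /= chart_mapK//.
  by near: y; apply: open_nbhs_nbhs; split => //; exact: chart_dom_open.
exact: eq_continuous_at E cinv.
Unshelve. all: by end_near. Qed.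

Lemma proper_bounded_below f : continuous f -> proper_fun f ->
  exists m, forall x, m <= f x.
Proof.
move=> cf pf; have [K cK Kf] := pf 0.
have [KE|/set0P K0] := eqVneq K set0.
  by exists 0 => x; apply/ltW/Kf; rewrite KE.
have [|z zK zmin] := compact_EVT_min K0 cK (f := f).
  exact: continuous_subspaceT.
exists (Num.min 0 (f z)) => x; rewrite ge_min.
have [Kx|Kx] := pselect (K x); last by rewrite ltW// Kf.
by rewrite zmin ?orbT// inE.
Qed.

Lemma compact_bounded_above f (K : set M) : continuous f -> compact K ->
  exists T, forall x, K x -> f x <= T.
Proof.
move=> cf cK; have [->|/set0P K0] := eqVneq K set0; first by exists 0.
have [|z zK zmax] := compact_EVT_max K0 cK (f := f).
  exact: continuous_subspaceT.
by exists (f z) => x Kx; apply: zmax; rewrite inE.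
Qed.

Lemma proper_comp f psi : proper_fun f ->
  (forall r, exists s, forall x, s < f x -> r < psi (f x)) ->
  proper_fun (psi \o f).
Proof.
move=> pf H r; have [s sP] := H r; have [K cK Kf] := pf s.
by exists K => // x Kx; apply/sP/Kf.
Qed.

End SecondOrderBounds.

(** * Auxiliary functions of one real variable *)

Section OneVariable.
Context {R : realType}.
Implicit Types (f g G : R -> R) (t T : R).

Lemma C2_square (m : R) :
  C2_on setT (fun t => (t + m) ^+ 2) (fun t => 2 * (t + m)) (fun=> 2).
Proof.
have D t : is_derive t 1 (fun s : R => s + m) 1.
  by apply: is_derive_eq; rewrite addr0.
split=> t _.
- apply: (is_derive_eq (@is_deriveX _ _ (fun s : R => s + m) 2 t 1 1 (D t))).
  by rewrite /GRing.scale/= expr1 mulr1.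
- apply: (is_derive_eq (@is_deriveZ _ _ _ (fun s : R => s + m) 2 t 1 1 (D t))).
  by rewrite /GRing.scale/= mulr1.
- exact: cst_continuous.
Qed.

Lemma is_derive_div f g t (a b : R) : g t != 0 ->
  is_derive t 1 f a -> is_derive t 1 g b ->
  is_derive t 1 (fun s => f s / g s) ((a * g t - f t * b) / g t ^+ 2).
Proof.
move=> g0 fa gb; apply: (is_derive_eq (is_deriveM fa (is_deriveV g0 gb))).
by rewrite /GRing.scale/=; field.
Qed.

Lemma is_derive_sqrt f t (a : R) : 0 < f t -> is_derive t 1 f a ->
  is_derive t 1 (fun s => Num.sqrt (f s)) (a / (2 * Num.sqrt (f t))).
Proof.
move=> f0 fa; rewrite [X in is_derive _ _ _ X]mulrC.
exact: (is_derive1_comp (is_derive1_sqrt f0) fa).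
Qed.

Lemma C2_sqrtD1 : C2_on [set t : R | 0 <= t] (fun t => Num.sqrt (t + 1))
  (fun t => (2 * Num.sqrt (t + 1))^-1)
  (fun t => - (4 * (t + 1) * Num.sqrt (t + 1))^-1).
Proof.
have D (t : R) : is_derive t 1 (fun s : R => s + 1) 1.
  exact: is_derive_shift.
have S (t : R) : 0 <= t -> is_derive t 1 (fun s => Num.sqrt (s + 1))
    (2 * Num.sqrt (t + 1))^-1.
  move=> t0; have t1 : 0 < t + 1 by rewrite ltr_wpDl.
  by have := @is_derive_sqrt (fun s : R => s + 1) t 1 t1 (D t); rewrite div1r.
split=> t /= t0; have t1 : 0 < t + 1 by rewrite ltr_wpDl.
- exact: S.
- have s0 : 2 * Num.sqrt (t + 1) != 0 by rewrite gt_eqF// mulr_gt0// sqrtr_gt0.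
  have S2 : is_derive t 1 (fun s : R => 2 * Num.sqrt (s + 1))
      (2 * (2 * Num.sqrt (t + 1))^-1) by exact: is_deriveZ (S t t0).
  have H := (@is_deriveV _ (fun s : R => 2 * Num.sqrt (s + 1)) _ _ _ s0 S2).
  apply: (is_derive_eq H).
  rewrite /GRing.scale/= exprMn sqr_sqrtr ?ltW// invfM.
  have s1 : Num.sqrt (t + 1) != 0 by rewrite gt_eqF// sqrtr_gt0.
  by field; rewrite s1 gt_eqF.
- have c1 : {for t, continuous (fun s : R => s + 1)}.
    exact: is_derive_continuous (D t).
  apply: continuousN; apply: continuousV; last apply: continuousM.
  + by rewrite gt_eqF// !mulr_gt0// sqrtr_gt0.
  + by apply: continuousM => //; exact: cst_continuous.
  + exact: is_derive_continuous (S t t0).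
Qed.

(** Powers at least 2 of the positive part of [t - T] are differentiable, even
    at [T]. *)
Lemma is_derive_posX (k : nat) T t :
  is_derive t 1 (fun s : R => Num.max (s - T) 0 ^+ k.+2)
    (k.+2%:R * Num.max (t - T) 0 ^+ k.+1).
Proof.
have cm : {for t, continuous (fun s : R => Num.max (s - T) 0)}.
  apply: (@continuous_max _ _ (fun s : R => s - T) (cst 0)).
    by apply: continuousB; [exact: cvg_id|exact: cst_continuous].
  exact: cst_continuous.
have [tT|Tt|tT] := ltgtP t T.
- rewrite max_r ?subr_le0 ?ltW// expr0n/= mulr0.
  apply: (near_eq_is_derive _ (is_derive_cst 0 t 1)).
  near=> s; rewrite /= max_r ?expr0n// subr_le0 ltW//.
  near: s; exact: lt_nbhsl.
- rewrite max_l ?subr_ge0 ?ltW//.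
  have D : is_derive t 1 (fun s : R => s - T) 1 by exact: is_derive_shift.
  apply: (@near_eq_is_derive _ _ _ ((fun s : R => s - T) ^+ k.+2)).
    near=> s; rewrite max_l ?exprfctE// subr_ge0 ltW//.
    by near: s; exact: lt_nbhsr.
  have H := (@is_deriveX _ _ (fun s : R => s - T) k.+2 t 1 1 D).
  apply: (is_derive_eq H).
  by rewrite /GRing.scale/= mulr1.
- rewrite -tT subrr maxxx expr0n/= mulr0; apply/is_derive1_caratheodory.
  exists (fun s => Num.max (s - t) 0 ^+ k.+1); split.
  + move=> z; rewrite subrr maxxx [0 ^+ _]expr0n/= subr0.
    have [zt|zt] := leP (z - t) 0; first by rewrite !expr0n mul0r.
    by rewrite [LHS]exprSr.
  + rewrite -tT in cm.
    exact: (@continuous_comp _ _ _ (fun s : R => Num.max (s - t) 0)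
      (fun y : R => y ^+ k.+1) t cm (@exprn_continuous _ _ _)).
  + by rewrite subrr maxxx expr0n.
Unshelve. all: by end_near.
Qed.

(** With [m] the positive part of [t - T], the function is [m^3 / (1 + m^2)]: it
    vanishes to third order at [T] and is asymptotic to [m] at infinity. *)
Lemma cutoff_exists T : exists psi dpsi ddpsi : R -> R,
  [/\ C2_on setT psi dpsi ddpsi,
      forall t, t <= T -> dpsi t = 0 /\ ddpsi t = 0,
      forall t, 0 <= dpsi t <= 2,
      forall t, ddpsi t <= 3 &
      forall t, T + 1 <= t -> (t - T) / 2 <= psi t].
Proof.
pose m (s : R) := Num.max (s - T) 0.
pose q k (s : R) := m s ^+ k.
have qD k t : is_derive t 1 (q k.+2) (k.+2%:R * q k.+1 t).
  exact: is_derive_posX.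
pose num s := 3 * q 2%N s + q 4%N s.
pose den s := 1 + 2 * q 2%N s + q 4%N s.
pose psi s := q 3%N s / (1 + q 2%N s).
pose dpsi s := num s / den s.
(* the derivative of num / den, after cancellation of a factor 1 + m^2 *)
pose ddpsi s := (6 * q 1%N s - 2 * q 3%N s) / (1 + q 2%N s) ^+ 3.
have m0 s : 0 <= m s by rewrite /m le_max lexx orbT.
have d1 s : 0 < 1 + q 2%N s by rewrite ltr_wpDr// exprn_ge0.
have d2 s : 0 < den s.
  by rewrite /den !ltr_wpDr// ?mulr_ge0// exprn_ge0.
have mc : continuous m.
  move=> t; apply: (@continuous_max _ _ (fun s : R => s - T) (cst 0)).
    by apply: continuousB; [exact: cvg_id|exact: cst_continuous].
  exact: cst_continuous.
have qc k : continuous (q k).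
  move=> t; exact: (@continuous_comp _ _ _ m (fun y : R => y ^+ k) t (mc t)
    (@exprn_continuous _ _ _)).
have D1 t : is_derive t 1 (fun s => 1 + q 2%N s) (2 * q 1%N t).
  apply: (is_derive_eq (is_deriveD (is_derive_cst (1 : R) t 1) (qD 0%N t))).
  by rewrite add0r.
have Dn t : is_derive t 1 num (6 * q 1%N t + 4 * q 3%N t).
  apply: (is_derive_eq (is_deriveD (is_deriveZ 3 (qD 0%N t)) (qD 2%N t))).
  by rewrite /GRing.scale/=; ring.
have Dd t : is_derive t 1 den (4 * q 1%N t + 4 * q 3%N t).
  apply: (is_derive_eq (is_deriveD (is_deriveD (is_derive_cst (1 : R) t 1)
    (is_deriveZ 2 (qD 0%N t))) (qD 2%N t))).
  by rewrite /GRing.scale/=; ring.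
exists psi, dpsi, ddpsi; split.
- split=> t _.
  + apply: (is_derive_eq (is_derive_div _ (qD 1%N t) (D1 t))).
      by rewrite gt_eqF.
    have := d1 t; have := d2 t; rewrite /dpsi /num /den /q => e2 e1.
    by field; rewrite !gt_eqF.
  + apply: (is_derive_eq (is_derive_div _ (Dn t) (Dd t))).
      by rewrite gt_eqF.
    have := d1 t; have := d2 t; rewrite /ddpsi /num /den /q => e2 e1.
    by field; rewrite !gt_eqF.
  + apply: continuousM.
      apply: continuousB; apply: continuousM;
        by [exact: cst_continuous|exact: qc].
    apply: continuousV; first by rewrite gt_eqF// exprn_gt0.
    apply: (@continuous_comp _ _ _ (fun s => 1 + q 2%N s)
      (fun y : R => y ^+ 3)).
      by apply: continuousD; [exact: cst_continuous|exact: qc].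
    exact: exprn_continuous.
- move=> t tT; have mt : m t = 0 by rewrite /m max_r// subr_le0.
  rewrite /dpsi /ddpsi /num /q mt !expr0n/= !mulr0 ?addr0 ?subr0 !mul0r.
  by [].
- move=> t; apply/andP; split; rewrite /dpsi.
    by rewrite divr_ge0 ?(ltW (d2 t))// addr_ge0 ?mulr_ge0 ?exprn_ge0.
  rewrite ler_pdivrMr// /num /den /q.
  have := exprn_ge0 2 (m0 t); have := exprn_ge0 4 (m0 t); lra.
- move=> t; rewrite /ddpsi ler_pdivrMr ?exprn_gt0// /q expr1.
  have h2 := exprn_ge0 2 (m0 t); have h3 := exprn_ge0 3 (m0 t).
  have h4 := exprn_ge0 4 (m0 t); have h6 := exprn_ge0 6 (m0 t).
  have hs := sqr_ge0 (m t - 1).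
  have -> : (1 + m t ^+ 2) ^+ 3 =
    1 + 3 * m t ^+ 2 + 3 * m t ^+ 4 + m t ^+ 6 by ring.
  by move: hs; rewrite sqrrB; lra.
- move=> t Tt; have mE : m t = t - T by rewrite /m max_l//; lra.
  rewrite /psi -mE ler_pdivlMr// /q.
  have m1 : 1 <= m t by rewrite mE; lra.
  have : m t <= m t ^+ 3 by rewrite ler_eXnr.
  have -> : m t / 2 * (1 + m t ^+ 2) = (m t + m t ^+ 3) / 2 by field.
  lra.
Qed.

Section Primitive.
Variable G : R -> R.
Hypothesis Ga : admissible G.

Lemma admissible_is_derive t : is_derive t 1 G (derive1 G t).
Proof.
rewrite derive1E; apply: derivableP.
exact: (@admissible_smooth _ _ Ga 0%N t).
Qed.

Lemma admissible_le : forall s t, 0 <= s -> s <= t -> G s <= G t.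
Proof.
apply: ger0_derive1_ndecry.
- by move=> x _; have [] := admissible_is_derive x.
- by move=> x; rewrite in_itv/= andbT => /ltW; exact: (admissible_derive Ga).
- apply: continuous_subspaceT => x.
  exact: is_derive_continuous (admissible_is_derive x).
Qed.

Lemma admissible_pos t : 0 <= t -> 0 < G t.
Proof.
move=> t0; apply: lt_le_trans (admissible_gt0 Ga) _; exact: admissible_le.
Qed.

Definition inv_sqrt t : R := (Num.sqrt (G t))^-1.

(** A primitive of [1 / sqrt G] on the nonnegative reals.  Nothing being known
    about the sign of [G] on the negative reals, [G] is replaced there by its
    value at 0; the integral starts at -1 so that the primitive is
    differentiable, hence continuous, at 0 too. *)
Definition primitive_inv_sqrt (u : R) : R :=
  (\int[lebesgue_measure]_(t in `[(-1)%R, u]) inv_sqrt (Num.max t 0))%R.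

Lemma continuous_inv_sqrt t : 0 <= t -> {for t, continuous inv_sqrt}.
Proof.
move=> t0; apply: continuousV.
  by rewrite gt_eqF// sqrtr_gt0 admissible_pos.
apply: (@continuous_comp _ _ _ G Num.sqrt); last exact: sqrt_continuous.
exact: is_derive_continuous (admissible_is_derive t).
Qed.

Lemma continuous_inv_sqrt_max :
  continuous (fun t : R => inv_sqrt (Num.max t 0)).
Proof.
move=> t; apply: (@continuous_comp _ _ _ (fun t : R => Num.max t 0) inv_sqrt).
  apply: (@continuous_max _ _ id (cst 0)); first exact: cvg_id.
  exact: cst_continuous.
by apply: continuous_inv_sqrt; rewrite le_max lexx orbT.
Qed.

Lemma is_derive_primitive (u : R) : -1 < u ->
  is_derive u 1 primitive_inv_sqrt (inv_sqrt (Num.max u 0)).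
Proof.
move=> u1; have uu : u < u + 1 by rewrite ltrDl.
have intf : lebesgue_measure.-integrable [set` `[-1, u + 1]]
    (EFin \o (fun t : R => inv_sqrt (Num.max t 0))).
  apply: continuous_compact_integrable; first exact: segment_compact.
  exact/continuous_subspaceT/continuous_inv_sqrt_max.
have [] := continuous_FTC1 uu intf _ (@continuous_inv_sqrt_max u).
  by [].
by move=> dF EF; rewrite -EF derive1E; apply: derivableP.
Qed.

Lemma C2_primitive : C2_on [set t | 0 < t] primitive_inv_sqrt inv_sqrt
  (fun t => - (Num.sqrt (G t)) ^- 2 * (derive1 G t / (2 * Num.sqrt (G t)))).
Proof.
split=> t /= t0; have Gt := admissible_pos (ltW t0);
  have sG := is_derive_sqrt Gt (admissible_is_derive t);
  have s0 : Num.sqrt (G t) != 0 by rewrite gt_eqF// sqrtr_gt0.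
- have := @is_derive_primitive t (lt_trans _ t0).
  by rewrite max_l ?ltW//; apply; rewrite ltrN10.
- exact: (@is_deriveV _ (fun s => Num.sqrt (G s)) _ _ _ s0 sG).
- have sc : {for t, continuous (fun s => Num.sqrt (G s))}.
    exact: is_derive_continuous sG.
  apply: continuousM.
    apply: continuousN; apply: continuousV; first by rewrite expf_neq0.
    apply: (@continuous_comp _ _ _ (fun s => Num.sqrt (G s))
      (fun y : R => y ^+ 2)) => //.
    exact: exprn_continuous.
  apply: continuousM.
    apply: (@is_derive_continuous _ _ _ ('D_1 (derive1 G) t)).
    exact/derivableP/(@admissible_smooth _ _ Ga 1%N t).
  apply: continuousV; first by rewrite mulf_neq0.
  by apply: continuousM => //; exact: cst_continuous.
Qed.

(** Otherwise the primitive, being nondecreasing, would have a finite limit at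
    infinity, and the integral of [1 / sqrt G] would be finite. *)
Lemma primitive_unbounded r : exists2 s, 0 <= s &
  forall u, s < u -> r < primitive_inv_sqrt u.
Proof.
apply: contrapT => H.
have Pc (x : R) : 0 <= x -> {for x, continuous primitive_inv_sqrt}.
  move=> x0; apply: is_derive_continuous (is_derive_primitive _).
  by rewrite (lt_le_trans _ x0)// ltrN10.
have Pd (x : R) : 0 < x -> is_derive x 1 primitive_inv_sqrt (inv_sqrt x).
  exact: (C2_on_derive C2_primitive).
have Pm : forall x y, 0 <= x -> x <= y ->
    primitive_inv_sqrt x <= primitive_inv_sqrt y.
  apply: ger0_derive1_ndecry => [x|x|].
  - by rewrite in_itv/= andbT => x0; have [] := Pd x x0.
  - rewrite in_itv/= andbT => x0; have [_] := Pd x x0; rewrite -derive1E => ->.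
    by rewrite invr_ge0 sqrtr_ge0.
  - apply: continuous_in_subspaceT => x.
    by rewrite inE/= in_itv/= andbT; exact: Pc.
have Pr x : 0 <= x -> primitive_inv_sqrt x <= r.
  move=> x0; rewrite leNgt; apply/negP => rx; apply: H; exists x => // u xu.
  by rewrite (lt_le_trans rx)// Pm// ltW.
pose F (x : R) := primitive_inv_sqrt (Num.max x 0).
have Fcvg : F x @[x --> +oo] --> sup (range F).
  apply: nondecreasing_cvgr.
    move=> x y xy; apply: Pm; first by rewrite le_max lexx orbT.
    by rewrite ge_max !le_max xy lexx orbT.
  by exists r => _ [x _ <-]; apply: Pr; rewrite le_max lexx orbT.
have Pcvg : primitive_inv_sqrt x @[x --> +oo] --> sup (range F).
  apply: cvg_trans Fcvg; apply: near_eq_cvg.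
  by near=> x; rewrite /F max_l.
have := admissible_integral Ga.
rewrite (@ge0_continuous_FTC2y _ inv_sqrt primitive_inv_sqrt 0 _ _ _ Pcvg) //.
- by move=> x _; rewrite invr_ge0 sqrtr_ge0.
- apply: continuous_in_subspaceT => x; rewrite inE/= in_itv/= andbT.
  exact: continuous_inv_sqrt.
- by move=> x x0; have [] := Pd x x0.
- exact/cvg_at_right_filter/Pc.
- move=> x; rewrite in_itv/= andbT => x0.
  by have [_] := Pd x x0; rewrite derive1E.
Unshelve. all: by end_near. Qed.

End Primitive.

(** The integral is infinite because [1 / sqrt (1 + t^2) >= 1 / (1 + t)], whose
    integral up to [exp A - 1] is [A]; the quotient in the last condition is
    [t (1 + t) / (1 + t^2) <= 2]. *)
Lemma admissible_1DX2 : admissible (fun t : R => 1 + t ^+ 2).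
Proof.
have GE : (fun t : R => 1 + t ^+ 2) = horner (1 + 'X^2).
  by apply/funext => t; rewrite !hornerE.
have D t : is_derive t 1 (fun t : R => 1 + t ^+ 2) (2 * t).
  rewrite GE; apply: is_derive_eq; rewrite derivD derivXn !(hornerE, derivC)/=.
  ring.
have G1 t : 1 <= 1 + t ^+ 2 by rewrite lerDl sqr_ge0.
have G0 t : 0 < 1 + t ^+ 2 by exact: lt_le_trans (G1 t).
split.
- move=> k t; rewrite GE.
  suff [p ->] : exists p : {poly R}, derive1n k (horner (1 + 'X^2)) = horner p.
    exact: derivable_horner.
  elim: k => [|k [p IH]]; first by exists (1 + 'X^2).
  by exists p^`()%R; rewrite derive1nS IH derivE.
- by move=> t _; exact/ltW.
- exact: G0.
- by move=> t t0; rewrite derive1E; have [_ ->] := D t; rewrite mulr_ge0.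
- apply/eqyP => A A0.
  pose N := expR A.
  have N1 : 1 < N by rewrite expR_gt1.
  have L (x : R) : -1 < x -> is_derive x 1 (fun s : R => ln (s + 1)) (x + 1)^-1.
    move=> x1; have x0 : 0 < x + 1 by lra.
    apply: (is_derive_eq (@is_derive1_comp R (@ln R) (fun s : R => s + 1) x _ 1
      (is_derive1_ln x0) _)); first exact: is_derive_shift.
    by rewrite mulr1.
  have Lc (x : R) : -1 < x -> {for x, continuous (fun s : R => ln (s + 1))}.
    by move=> x1; exact: is_derive_continuous (L x x1).
  have cf : {within `[0, N - 1], continuous (fun s : R => (s + 1)^-1)}.
    apply: continuous_in_subspaceT => x; rewrite inE/= in_itv/= => /andP[x0 _].
    apply: (@continuousV R R (fun s : R => s + 1)).
      by rewrite gt_eqF//; lra.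
    exact: is_derive_continuous (is_derive_shift _ _ _).
  have E : (\int[lebesgue_measure]_(x in `[0%R, (N - 1)%R])
      ((x + 1)^-1)%:E = A%:E)%E.
    rewrite (@continuous_FTC2 _ _ (fun s : R => ln (s + 1)) _ _ _ cf).
    + by rewrite subrK add0r ln1 /N expRK sube0.
    + by rewrite subr_gt0.
    + split.
      * move=> x; rewrite in_itv/= => /andP[x0 _].
        by have [] := L x (lt_trans (ltrN10 _) x0).
      * by apply/cvg_at_right_filter/Lc; rewrite ltrN10.
      * by apply/cvg_at_left_filter/Lc; lra.
    + move=> x; rewrite in_itv/= => /andP[x0 _].
      by have [_] := L x (lt_trans (ltrN10 _) x0); rewrite derive1E.
  have mc : continuous (fun t : R => (Num.sqrt (1 + t ^+ 2))^-1).
    move=> t; apply: (@continuousV R R (fun t : R => Num.sqrt (1 + t ^+ 2))).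
      by rewrite gt_eqF// sqrtr_gt0.
    apply: (@continuous_comp _ _ _ (fun t : R => 1 + t ^+ 2) Num.sqrt).
      exact: is_derive_continuous (D t).
    exact: sqrt_continuous.
  rewrite -E; apply: (@le_trans _ _
    (\int[lebesgue_measure]_(t in `[0%R, (N - 1)%R])
      ((Num.sqrt (1 + t ^+ 2))^-1)%:E)%E).
    apply: ge0_le_integral => //=.
    + move=> x; rewrite in_itv/= => /andP[x0 _].
      by rewrite lee_fin invr_ge0; lra.
    + apply/measurable_EFinP.
      exact: subspace_continuous_measurable_fun.
    + apply/measurable_EFinP; apply: measurable_funTS.
      exact: continuous_measurable_fun.
    + move=> x; rewrite in_itv/= => /andP[x0 _]; rewrite lee_fin lef_pV2 ?posrE.
      * rewrite -[leRHS]ger0_norm; last by lra.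
        by rewrite -sqrtr_sqr ler_wsqrtr// sqrrD; lra.
      * by lra.
      * by rewrite sqrtr_gt0.
  apply: ge0_subset_integral => //=.
  + apply/measurable_EFinP; apply: measurable_funTS.
    exact: continuous_measurable_fun.
  + by move=> x /=; rewrite !in_itv/= => /andP[->].
- rewrite limf_esupE; apply: (@le_lt_trans _ _ (2%:E)); last exact: ltry.
  apply: ge_ereal_inf.
  exists (ereal_sup ((fun t : R =>
    (t * (1 + Num.sqrt t ^+ 2) / (1 + t ^+ 2))%:E) @` [set t : R | 0 < t])).
    by exists [set t : R | 0 < t] => //; exists 0; split.
  apply: ge_ereal_sup => _ [t /= t0 <-].
  rewrite lee_fin sqr_sqrtr ?(ltW t0)// ler_pdivrMr//.
  have := sqr_ge0 (t - 1); rewrite sqrrB; nra.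
Qed.

End OneVariable.

(** * The equivalence for an abstract second-order bound *)

Section Equivalence.
Context {R : realType} {n : nat} {M : riemannian R n}.
Variable P : chart R n M -> (M -> R) -> M -> R -> Prop.
Hypothesis Pb : second_order_bound P.

(** Bounds outside a compact set become global bounds after composition with a
    function that is constant on the values taken on that set. *)
Lemma bound_across_compact (p : M -> R) (K : set M) (a b : R) :
  CkM 2 p -> proper_fun p -> compact K -> 0 <= a -> 0 <= b ->
  grad_norm_le (~` K) p (fun=> a) -> bound_on P (~` K) p (fun=> b) ->
  exists (phi : M -> R) (C D : R),
    CkM 2 phi /\ 0 < C /\ 0 < D /\ proper_fun phi /\
    grad_norm_le setT phi (fun=> C) /\ bound_on P setT phi (fun=> D).
Proof.
move=> p2 pp cK a0 b0 pa pb.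
have [T KT] := compact_bounded_above (CkM_continuous p2) cK.
have [psi [dpsi [ddpsi [psi2 flat dpsi02 ddpsi3 psiT]]]] := cutoff_exists T.
have pW x : setT (p x) by [].
exists (psi \o p), (2 * a + 1), (2 * b + 3 * a ^+ 2 + 1).
have C0 : 0 < 2 * a + 1 by rewrite ltr_wpDl// mulr_ge0.
have D0 : 0 < 2 * b + 3 * a ^+ 2 + 1.
  by rewrite ltr_wpDl// addr_ge0// mulr_ge0// sqr_ge0.
split; first exact: CkM2_comp p2 pW psi2.
split=> //; split=> //; split.
  apply: proper_comp pp _ => r; exists (Num.max (T + 1) (2 * r + T)) => x.
  rewrite gt_max => /andP[x1 x2]; apply: lt_le_trans (psiT _ (ltW x1)).
  by rewrite ltr_pdivlMr//; lra.
split=> x c _ cx; have [Kx|Kx] := pselect (K x).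
- have [dx _] := flat _ (KT x Kx).
  by rewrite (grad_comp p2 pW psi2 cx) dx norm_gZ normr0 mul0r ltW.
- have /andP[d0 d2] := dpsi02 (p x).
  rewrite (grad_comp p2 pW psi2 cx) norm_gZ ger0_norm//.
  apply: (@le_trans _ _ (2 * a)); last by lra.
  by apply: ler_pM => //; [exact: norm_g_ge0|exact: pa].
- have [dx ddx] := flat _ (KT x Kx).
  apply: (sob_le Pb cx (ltW D0)).
  exact: (sob_flat Pb p2 pW psi2 cx).
- have /andP[d0 d2] := dpsi02 (p x).
  have le : dpsi (p x) * b + 3 * a ^+ 2 <= 2 * b + 3 * a ^+ 2 + 1.
    by have := ler_wpM2r b0 d2; lra.
  apply: (sob_le Pb cx le).
  by apply: (sob_comp Pb p2 pW psi2 cx) => //; [exact: pa|exact: pb].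
Qed.

Lemma admissible_to_bounded (gamma : M -> R) (K : set M) (A B : R)
    (G : R -> R) :
  (forall x, 0 <= gamma x) -> CkM 2 gamma -> compact K -> 0 < A -> 0 < B ->
  admissible G -> proper_fun gamma ->
  grad_norm_le (~` K) gamma (fun x => A * Num.sqrt (gamma x)) ->
  bound_on P (~` K) gamma
    (fun x => B * Num.sqrt (gamma x * G (Num.sqrt (gamma x)))) ->
  exists (phi : M -> R) (C D : R),
    CkM 2 phi /\ 0 < C /\ 0 < D /\ proper_fun phi /\
    grad_norm_le setT phi (fun=> C) /\ bound_on P setT phi (fun=> D).
Proof.
move=> g0 g2 cK A0 B0 Ga pg gA gB.
have Gpos t : 0 <= t -> 0 < G t by exact: admissible_pos.
pose w : M -> R := (fun t => Num.sqrt (t + 1)) \o gamma.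
have g1 x : 0 < gamma x + 1 by rewrite ltr_wpDl.
have w2 : CkM 2 w by exact: (CkM2_comp g2 g0 C2_sqrtD1).
have w0 x : 0 < w x by rewrite sqrtr_gt0.
have sw x : Num.sqrt (gamma x) <= w x by rewrite ler_wsqrtr// lerDl.
have pw : proper_fun w.
  apply: proper_comp pg _ => r; exists (r ^+ 2) => x rx.
  apply: (le_lt_trans (ler_norm r)).
  by rewrite -sqrtr_sqr ltr_sqrt// (lt_le_trans rx)// lerDl.
have dw_ge0 x : 0 <= (2 * Num.sqrt (gamma x + 1))^-1.
  by rewrite invr_ge0 mulr_ge0// sqrtr_ge0.
have dw x y : y <= w x -> (2 * Num.sqrt (gamma x + 1))^-1 * y <= 1.
  by move=> yw; rewrite mulrC ler_pdivrMr ?mulr_gt0 ?w0// mul1r;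
    have := w0 x; rewrite /w/= in yw *; lra.
have wA : grad_norm_le (~` K) w (fun=> A).
  apply: (grad_norm_le_comp g2 g0 C2_sqrtD1 gA) => x _; first exact: dw_ge0.
  by rewrite mulrCA -[leRHS]mulr1 ler_wpM2l ?dw// ltW.
have wB : bound_on P (~` K) w (fun x => B * Num.sqrt (G (w x))).
  apply: (bound_on_comp (e := fun=> 0) g2 g0 C2_sqrtD1 Pb gA gB) => // x _.
    by rewrite oppr_le0 invr_ge0 !mulr_ge0 ?sqrtr_ge0// ltW.
  rewrite mul0r addr0 mulrCA ler_wpM2l ?(ltW B0)// sqrtrM// mulrA.
  rewrite -[leRHS]mul1r ler_pM ?sqrtr_ge0 ?mulr_ge0 ?sqrtr_ge0//.
    by rewrite dw.
  rewrite ler_wsqrtr//.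
  exact: (admissible_le Ga (sqrtr_ge0 _) (sw x)).
have wp x : [set t | 0 < t] (w x) by exact: w0.
have C2P := C2_primitive Ga.
pose p : M -> R := primitive_inv_sqrt G \o w.
have p2 : CkM 2 p by exact: (CkM2_comp w2 wp C2P).
have pp : proper_fun p.
  apply: proper_comp pw _ => r; have [s s0 sP] := primitive_unbounded Ga r.
  by exists s => x; exact: sP.
have inv0 x : 0 <= inv_sqrt G (w x) by rewrite invr_ge0 sqrtr_ge0.
apply: (@bound_across_compact p K (A / Num.sqrt (G 0)) B) => //.
- by rewrite divr_ge0 ?sqrtr_ge0 ?ltW.
- exact: ltW.
- apply: (grad_norm_le_comp w2 wp C2P wA) => x _; first exact: inv0.
  rewrite mulrC ler_wpM2l ?(ltW A0)//.
  rewrite lef_pV2 ?posrE ?sqrtr_gt0 ?Gpos ?(ltW (w0 x))//.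
  by rewrite ler_wsqrtr// (admissible_le Ga)// ltW.
- apply: (bound_on_comp (e := fun=> 0) w2 wp C2P Pb wA wB) => // x _.
    rewrite mulNr oppr_le0 mulr_ge0 ?invr_ge0 ?sqr_ge0// divr_ge0//.
    exact/(admissible_derive Ga)/ltW.
  rewrite mul0r addr0 mulrCA mulVf ?mulr1//.
  by rewrite gt_eqF// sqrtr_gt0 Gpos// ltW.
Qed.

Lemma bounded_to_admissible (phi : M -> R) (C D : R) :
  CkM 2 phi -> 0 < C -> 0 < D -> proper_fun phi ->
  grad_norm_le setT phi (fun=> C) -> bound_on P setT phi (fun=> D) ->
  exists (gamma : M -> R) (K : set M) (A B : R) (G : R -> R),
    (forall x, 0 <= gamma x) /\ CkM 2 gamma /\ compact K /\
    0 < A /\ 0 < B /\ admissible G /\ proper_fun gamma /\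
    grad_norm_le (~` K) gamma (fun x => A * Num.sqrt (gamma x)) /\
    bound_on P (~` K) gamma
      (fun x => B * Num.sqrt (gamma x * G (Num.sqrt (gamma x)))).
Proof.
move=> f2 C0 D0 pf fC fD.
have [m mf] := proper_bounded_below (CkM_continuous f2) pf.
have fW x : setT (phi x) by [].
have psi2 := @C2_square R (1 - m).
have u1 x : 1 <= phi x + (1 - m) by have := mf x; lra.
have u0 x : 0 <= phi x + (1 - m) by exact: le_trans (u1 x).
have d0 x : 0 <= 2 * (phi x + (1 - m)) by rewrite mulr_ge0.
pose gamma : M -> R := (fun t => (t + (1 - m)) ^+ 2) \o phi.
have sg x : Num.sqrt (gamma x) = phi x + (1 - m).
  by rewrite sqrtr_sqr ger0_norm.
(* B = 2 D + 2 C^2: as 1 <= phi + 1 - m = sqrt gamma, the constant term 2 C^2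
   coming from the second derivative is at most 2 C^2 sqrt gamma *)
exists gamma, set0, (2 * C), (2 * D + 2 * C ^+ 2), (fun t => 1 + t ^+ 2).
split; first by move=> x; exact: sqr_ge0.
split; first exact: CkM2_comp f2 fW psi2.
split; first exact: compact0.
split; first by rewrite mulr_gt0.
split; first by rewrite addr_gt0 ?mulr_gt0 ?exprn_gt0.
split; first exact: admissible_1DX2.
split.
  apply: proper_comp pf _ => r; exists (r + m) => x rx.
  have : phi x + (1 - m) <= (phi x + (1 - m)) ^+ 2 by rewrite ler_eXnr.
  by lra.
have fC' : grad_norm_le (~` set0) phi (fun=> C) by move=> x c _; exact: fC.
have fD' : bound_on P (~` set0) phi (fun=> D) by move=> x c _; exact: fD.
split.
  apply: (grad_norm_le_comp f2 fW psi2 fC') => x _; first exact: d0.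
  by rewrite sg; lra.
apply: (bound_on_comp (e := fun=> 2) f2 fW psi2 Pb fC' fD') => // x _.
have le : phi x + (1 - m) <= Num.sqrt (gamma x * (1 + Num.sqrt (gamma x) ^+ 2)).
  rewrite -[leLHS]sg ler_wsqrtr// ler_peMr ?sqr_ge0// lerDl sqr_ge0//.
apply: (@le_trans _ _ ((2 * D + 2 * C ^+ 2) * (phi x + (1 - m)))); last first.
  by rewrite ler_wpM2l// addr_ge0 ?mulr_ge0 ?sqr_ge0 ?ltW.
have : 2 * C ^+ 2 <= 2 * C ^+ 2 * (phi x + (1 - m)).
  by rewrite ler_peMr// mulr_ge0 ?sqr_ge0.
by lra.
Qed.

Lemma admissible_iff_bounded :
  (exists (gamma : M -> R) (K : set M) (A B : R) (G : R -> R),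
      (forall x, 0 <= gamma x) /\ CkM 2 gamma /\ compact K /\
      0 < A /\ 0 < B /\ admissible G /\ proper_fun gamma /\
      grad_norm_le (~` K) gamma (fun x => A * Num.sqrt (gamma x)) /\
      bound_on P (~` K) gamma
        (fun x => B * Num.sqrt (gamma x * G (Num.sqrt (gamma x)))))
  <->
  (exists (phi : M -> R) (C D : R),
      CkM 2 phi /\ 0 < C /\ 0 < D /\ proper_fun phi /\
      grad_norm_le setT phi (fun=> C) /\ bound_on P setT phi (fun=> D)).
Proof.
split.
  move=> [gamma [K [A [B [G [g0 [g2 [cK [A0 [B0 [Ga [pg [gA gB]]]]]]]]]]]]].
  exact: (admissible_to_bounded g0 g2 cK A0 B0 Ga pg gA gB).
move=> [phi [C [D [f2 [C0 [D0 [pf [fC fD]]]]]]]].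
exact: (bounded_to_admissible f2 C0 D0 pf fC fD).
Qed.

End Equivalence.

Theorem proposition2p1 (R : realType) (n : nat) (M : riemannian R n) :
  ((exists (gamma : M -> R) (K : set M) (A B : R) (G : R -> R),
      (forall x, 0 <= gamma x) /\ CkM 2 gamma /\ compact K /\
      0 < A /\ 0 < B /\ admissible G /\ proper_fun gamma /\
      grad_norm_le (~` K) gamma (fun x => A * Num.sqrt (gamma x)) /\
      Hess_le (~` K) gamma
        (fun x => B * Num.sqrt (gamma x * G (Num.sqrt (gamma x)))))
   <->
   (exists (phi : M -> R) (C D : R),
      CkM 2 phi /\ 0 < C /\ 0 < D /\ proper_fun phi /\
      grad_norm_le setT phi (fun=> C) /\ Hess_le setT phi (fun=> D)))
  /\
  ((exists (gamma : M -> R) (K : set M) (A B : R) (G : R -> R),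
      (forall x, 0 <= gamma x) /\ CkM 2 gamma /\ compact K /\
      0 < A /\ 0 < B /\ admissible G /\ proper_fun gamma /\
      grad_norm_le (~` K) gamma (fun x => A * Num.sqrt (gamma x)) /\
      Laplacian_le (~` K) gamma
        (fun x => B * Num.sqrt (gamma x * G (Num.sqrt (gamma x)))))
   <->
   (exists (phi : M -> R) (C D : R),
      CkM 2 phi /\ 0 < C /\ 0 < D /\ proper_fun phi /\
      grad_norm_le setT phi (fun=> C) /\ Laplacian_le setT phi (fun=> D))).
Proof.
split; first exact: (admissible_iff_bounded sob_hess).
exact: (admissible_iff_bounded sob_laplacian).
Qed.
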